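(* Consider the M/G/$\infty$ polling system with $N\geqslant 2$ queues described in the context, in which in each cycle the servers perform a Hamiltonian tour: they visit every queue exactly once, in an order that is chosen at the start of the cycle and may depend on the state $n=(n_1,\ldots,n_N)$ of the system at the start of the cycle ($n_i$ being the number of customers then present at queue $i$). For a visiting order $\pi=(\pi(1),\ldots,\pi(N))$ (a permutation of $\{1,\ldots,N\}$), let $\mathbb{E}_n[\theta(\pi)]$ be the expected throughput of the cycle, i.e. the expected total number of customers (over all queues) that complete service during the cycle, given the initial state $n$ and the order $\pi$. Then, for every initial state $n$, the order $\pi$ maximises $\mathbb{E}_n[\theta(\cdot)]$ over all permutations of $\{1,\ldots,N\}$ if and only if the queues are arranged in $\pi$ according to an increasing (i.e. non-decreasing) sequence of the index $$\frac{\lambda_i p_i}{\mathbb{E}[V_i]+\mathbb{E}[D_i]},\qquad p_i=\mathbb{P}[B_i\leqslant V_i].$$ In particular, the optimal visiting order is independent of the numbers of customers $n$ present at the various queues at the start of the cycle.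
   Context: The system has $N\geqslant2$ infinite-buffer queues attended by a single group of infinitely many servers moving together. Customers arrive at queue $i$ according to a Poisson process with rate $\lambda_i>0$; the arrival processes are independent. When the servers enter queue $i$ they stay there for a random visit time $V_i>0$, and during this time queue $i$ works as an M/G/$\infty$ queue: every customer present when the servers enter starts service immediately at that moment, and every customer arriving during the visit starts service immediately on arrival. Each service time at queue $i$ is distributed as $B_i$; a customer whose service is completed before the end of the visit leaves the system, and a customer whose service is not completed by the end of the visit stays in the queue and receives, at the next visit, a fresh independent service time distributed as $B_i$. After the visit to queue $i$ the servers incur a switch-over time $D_i\geqslant 0$ (attached to the queue just visited, whichever queue comes next) before entering the next queue of the tour. All arrival processes, visit times, service times and switch-over times are mutually independent; the distributions may depend on $i$, and $\mathbb{E}[V_i],\mathbb{E}[D_i]<\infty$. The cycle starts at the moment when the servers enter the first queue of the tour; thus the queue in position $m$ of the tour $\pi$ is entered after time $\sum_{k=1}^{m-1}(V_{\pi(k)}+D_{\pi(k)})$. *)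

(* Defs.v *)
From HB Require Import structures.
From mathcomp Require Import all_boot all_order all_algebra all_fingroup finmap.
From mathcomp Require Import all_classical all_reals all_analysis.

Set Implicit Arguments.
Unset Strict Implicit.
Unset Printing Implicit Defensive.

Import Order.TTheory GRing.Theory Num.Theory.
Local Open Scope classical_set_scope.
Local Open Scope ring_scope.

Definition mutually_independent (d : measure_display) (T : measurableType d)
    (R : realType) (P : probability T R) (I : choiceType)
    (X : I -> {RV P >-> R}) : Prop :=
  forall (J : {fset I}) (A : I -> set R),
    (forall j, measurable (A j)) ->
    P (\bigcap_(j in [set` J]) (X j @^-1` A j)) =
    (\prod_(j <- J) P (X j @^-1` A j))%E.

(* Labels of the random inputs of one cycle.  [CustomerService i l] is the
   service time drawn for customer number l of queue i: customers 0, ..., n_i-1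
   are those present at the start of the cycle, the later ones are numbered in
   order of arrival.  One draw per customer is enough, because every queue is
   visited only once in a cycle. *)
Inductive input (N : nat) : Type :=
  | Visit of 'I_N
  | Switch of 'I_N
  | Service of 'I_N
  | CustomerService of 'I_N & nat
  | Interarrival of 'I_N & nat.

HB.instance Definition _ (N : nat) := gen_eqMixin (input N).
HB.instance Definition _ (N : nat) := gen_choiceMixin (input N).

Definition inputs (d : measure_display) (T : measurableType d) (R : realType)
    (P : probability T R) (N : nat) (V D B : 'I_N -> {RV P >-> R})
    (S U : 'I_N -> nat -> {RV P >-> R}) (x : input N) : {RV P >-> R} :=
  match x with
  | Visit i => V i
  | Switch i => D i
  | Service i => B i
  | CustomerService i l => S i l
  | Interarrival i k => U i k
  end.

Section Cycle.
Context (d : measure_display) (T : measurableType d) (R : realType)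
  (P : probability T R) (N : nat).
Variables (V D : 'I_N -> {RV P >-> R}) (S U : 'I_N -> nat -> {RV P >-> R}).

(* Time zero is the start of the cycle.  The Poisson arrival process of queue i
   is given by its interarrival times U i 0, U i 1, ..., the first one being
   measured from time zero; customers already present are given arrival
   time zero. *)
Definition arrival_time (n : 'I_N -> nat) (i : 'I_N) (l : nat) (w : T) : R :=
  if (l < n i)%N then 0 else \sum_(k < (l - n i).+1) U i k w.

Definition entry_time (pi : 'S_N) (m : 'I_N) (w : T) : R :=
  \sum_(k < N | (k < m)%N) (V (pi k) w + D (pi k) w).

(* A customer arriving at time a completes a service of length b during the
   visit [s, s + v]: the service starts at time max(a, s). *)
Definition completes (a s v b : R) : bool :=
  (a <= s + v) && (Num.max a s + b <= s + v).

Definition throughput (n : 'I_N -> nat) (pi : 'S_N) (w : T) : \bar R :=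
  (\sum_(m < N) \sum_(0 <= l <oo)
    ((completes (arrival_time n (pi m) l w) (entry_time pi m w)
                (V (pi m) w) (S (pi m) l w))%:R : R)%:E)%E.

Definition expected_throughput (n : 'I_N -> nat) (pi : 'S_N) : \bar R :=
  (\int[P]_w throughput n pi w)%E.

Definition optimal_order (n : 'I_N -> nat) (pi : 'S_N) : Prop :=
  forall pi' : 'S_N,
    (expected_throughput n pi' <= expected_throughput n pi)%E.

End Cycle.

Definition order_index (d : measure_display) (T : measurableType d)
    (R : realType) (P : probability T R) (N : nat) (lam : 'I_N -> R)
    (V D B : 'I_N -> {RV P >-> R}) (i : 'I_N) : R :=
  lam i * fine (P [set w | B i w <= V i w]) /
    (fine ('E_P[V i])%E + fine ('E_P[D i])%E).

(* Main.v *)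
(* A customer of a queue entered at time s and visited for a time v completes
   service, with a service time b >= 0, if and only if b <= v and it arrives
   before s + v - b.  The arrival times of the customers following the n
   initial ones are Erlang sums, and the Erlang distribution functions add up
   to the linear function y |-> lam * y.  Hence the expected number of
   completions is n p + lam E[(s + v - B) 1_{B <= v}], which by independence is
   lam p E[s] plus a term that does not depend on the order.  Up to a constant,
   the expected throughput is therefore the sum of c_i lam_j p_j over the pairs
   where i is visited before j, with c_i = E[V_i] + E[D_i].  An order maximises
   this sum if and only if it picks the larger of c_i lam_j p_j and
   c_j lam_i p_i for every pair, because a sorted order does so. *)

Require Import Defs.
From mathcomp Require Import all_boot all_order all_algebra all_fingroup finmap.
From mathcomp Require Import all_classical all_reals all_analysis.
From mathcomp Require Import measurable_realfun ring lra.

Set Implicit Arguments.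
Unset Strict Implicit.
Unset Printing Implicit Defensive.

Import Order.TTheory GRing.Theory Num.Theory.
Import numFieldNormedType.Exports.
Local Open Scope classical_set_scope.
Local Open Scope ring_scope.

(** * Sums over pairs of queues *)

Section ordering.
Context (R : realFieldType) (N : nat) (lam p c : 'I_N -> R).

Let w i := lam i * p i.

Definition ordering_value (pi : 'S_N) : R :=
  \sum_(m < N) w (pi m) * \sum_(k < N | (k < m)%N) c (pi k).

Definition sorted_order (pi : 'S_N) : Prop :=
  forall k m : 'I_N, (k <= m)%N ->
    w (pi k) / c (pi k) <= w (pi m) / c (pi m).

(** [(pi^-1)%g i] is the position of queue [i]. The value is symmetric in [z], so each unordered
    pair is counted twice and no representative has to be chosen. *)
Definition pair_value (pi : 'S_N) (z : 'I_N * 'I_N) : R :=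
  if ((pi^-1)%g z.1 < (pi^-1)%g z.2)%N then c z.1 * w z.2
  else if ((pi^-1)%g z.2 < (pi^-1)%g z.1)%N then c z.2 * w z.1 else 0.

Lemma ordering_value_pairs (pi : 'S_N) :
  ordering_value pi *+ 2 = \sum_z pair_value pi z.
Proof.
(* Reindexing both sums by [pi] replaces positions by queues. *)
have E (f : 'I_N -> 'I_N -> R) :
    \sum_(m < N) \sum_(k < N | (k < m)%N) f (pi k) (pi m)
    = \sum_i \sum_j (if ((pi^-1)%g i < (pi^-1)%g j)%N then f i j else 0).
  rewrite [RHS]exchange_big/= [RHS](reindex_inj (@perm_inj _ pi))/=.
  apply: eq_bigr => m _.
  rewrite [RHS](reindex_inj (@perm_inj _ pi))/= big_mkcond/=.
  by apply: eq_bigr => k _; rewrite !permK.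
have -> : ordering_value pi =
    \sum_(m < N) \sum_(k < N | (k < m)%N) c (pi k) * w (pi m).
  by apply: eq_bigr => m _; rewrite mulrC mulr_suml.
rewrite mulr2n {1}(E (fun i j => c i * w j)) (E (fun i j => c i * w j)).
(* One of the two copies is transposed, so that the two conditional terms at [(i, j)] add up to
   [pair_value]. *)
rewrite [X in _ + X]exchange_big/= -big_split/=.
rewrite -(pair_big xpredT xpredT (fun i j => pair_value pi (i, j)))/=.
  apply: eq_bigr => i _; rewrite -big_split/=.
  apply: eq_bigr => j _; rewrite /pair_value/=.
by case: ltngtP; rewrite ?addr0 ?add0r.
Qed.

Hypothesis c_gt0 : forall i, 0 < c i.

Let index_le i j : (w i / c i <= w j / c j) = (c j * w i <= c i * w j).
Proof. by rewrite ler_pdivrMr// mulrAC ler_pdivlMr// mulrC [w j * _]mulrC. Qed.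

(** Clearing positive denominators turns a comparison of indices into one of the two values a pair
    can take. Equal indices give equal values, so ties do not break the equivalence. *)
Lemma sorted_order_pairs (pi : 'S_N) :
  sorted_order pi <->
  forall z, z.1 != z.2 ->
    pair_value pi z = Num.max (c z.1 * w z.2) (c z.2 * w z.1).
Proof.
split=> [pi_sorted [i j]/= ij|pi_max k m].
  rewrite /pair_value/=; case: ltngtP => ltij.
  - have := pi_sorted _ _ (ltnW ltij); rewrite !permKV index_le => le1.
    by apply/esym/max_idPl.
  - have := pi_sorted _ _ (ltnW ltij); rewrite !permKV index_le => le1.
    by apply/esym/max_idPr.
  - by move/val_inj/perm_inj: ltij ij => -> /eqP.
rewrite leq_eqVlt => /predU1P[/val_inj -> //|km].
have /pi_max : (pi k, pi m).1 != (pi k, pi m).2.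
  by rewrite /= (inj_eq perm_inj); apply: contraTneq km => ->; rewrite ltnn.
rewrite /pair_value/= !permK km index_le => ->.
by rewrite le_max lexx orbT.
Qed.

Lemma pair_value_le (pi : 'S_N) (z : 'I_N * 'I_N) : z.1 != z.2 ->
  pair_value pi z <= Num.max (c z.1 * w z.2) (c z.2 * w z.1).
Proof.
move=> zE; rewrite /pair_value; case: ltngtP => E; rewrite ?le_max ?lexx ?orbT//.
by move/val_inj/perm_inj: E zE => -> /eqP.
Qed.

Lemma pair_value_diag (pi : 'S_N) (z : 'I_N * 'I_N) : z.1 = z.2 ->
  pair_value pi z = 0.
Proof. by move=> zE; rewrite /pair_value zE ltnn. Qed.

(** A sorted order attains the bound of [pair_value_le] at all pairs at once; this is what makes the
    pairwise bounds jointly sharp. *)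
Lemma sorted_order_exists : exists pi : 'S_N, sorted_order pi.
Proof.
pose le i j := w i / c i <= w j / c j.
have le_tot : total le by move=> i j; exact: le_total.
have le_tr : transitive le by move=> i j k; exact: le_trans.
pose s := sort le (enum 'I_N).
have s_sorted : sorted le s by exact: sort_sorted.
have /tuple_permP[pi piE] : perm_eq s (ord_tuple N) by rewrite perm_sort.
exists pi => k m km.
have s_nth (i : 'I_N) : nth k s i = pi i.
  by rewrite piE -tnth_nth tnth_mktuple tnth_ord_tuple.
have := sorted_leq_nth le_tr (fun=> lexx _) k s_sorted.
move=> /(_ k m); rewrite !s_nth; apply=> //.
- by rewrite inE size_sort size_enum_ord.
- by rewrite inE size_sort size_enum_ord.
Qed.

(** A sorted order dominates every order pair by pair. Against an optimal order the differences are
    nonnegative with sum at most zero, hence all zero, so the optimal order takes the maximum at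
    each pair. *)
Lemma optimal_ordering (pi : 'S_N) :
  (forall pi' : 'S_N, ordering_value pi' <= ordering_value pi) <->
  sorted_order pi.
Proof.
have le2 pi1 pi2 : (ordering_value pi1 <= ordering_value pi2) =
    (\sum_z pair_value pi1 z <= \sum_z pair_value pi2 z).
  by rewrite -!ordering_value_pairs ler_pMn2r.
split=> [pi_opt|pi_sorted pi'].
  have [s s_sorted] := sorted_order_exists.
  have := pi_opt s; rewrite le2 => le_s.
  have vals z : pair_value pi z <= pair_value s z.
    have [zE|zE] := eqVneq z.1 z.2; first by rewrite !pair_value_diag.
    by rewrite (sorted_order_pairs s).1// pair_value_le.
  apply/sorted_order_pairs => z zE.
  rewrite -((sorted_order_pairs s).1 s_sorted z zE).
  have /eqP : \sum_z (pair_value s z - pair_value pi z) == 0.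
    rewrite eq_le sumrB subr_le0 le_s /= -sumrB sumr_ge0// => i _.
    by rewrite subr_ge0.
  move/psumr_eq0P => /(_ _ z isT) /eqP; rewrite subr_eq0 => E.
  by apply/esym/eqP/E => i _; rewrite subr_ge0.
rewrite le2; apply: ler_sum => z _.
have [zE|zE] := eqVneq z.1 z.2; first by rewrite !pair_value_diag.
by rewrite ((sorted_order_pairs pi).1 pi_sorted z zE) pair_value_le.
Qed.

End ordering.

(** * Independence *)

Section independence.
Context (d : measure_display) (T : measurableType d) (R : realType)
  (P : probability T R).

Definition independent_functions d1 d2 (T1 : measurableType d1)
    (T2 : measurableType d2) (f : T -> T1) (g : T -> T2) : Prop :=
  forall A B, measurable A -> measurable B ->
    (P (f @^-1` A `&` g @^-1` B) = P (f @^-1` A) * P (g @^-1` B))%E.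

Context (I : choiceType) (X : I -> {RV P >-> R}).

(** A pi-system generating the sigma-algebra of the variables with labels in [J]. *)
Definition cylinders (J : set I) : set (set T) :=
  [set E | exists F : {fset I}, exists A : I -> set R,
    [/\ [set` F] `<=` J, forall j, measurable (A j) &
        E = \bigcap_(j in [set` F]) (X j @^-1` A j)]].

Lemma cylinders_setI_closed (J : set I) : setI_closed (cylinders J).
Proof.
move=> _ _ [F [A [FJ mA ->]]] [G [B [GJ mB ->]]].
exists (F `|` G)%fset.
(* Each family is padded with [setT] outside its own index set. *)
exists (fun j => (if j \in F then A j else setT) `&`
                 (if j \in G then B j else setT)); split.
- by move=> j /=; rewrite inE => /orP[/FJ|/GJ].
- by move=> j; apply: measurableI; case: ifP.
- apply/seteqP; split=> [w [wA wB] j /= jFG|w wAB].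
    by split; [case: ifP => // /wA|case: ifP => // /wB].
  split=> j /= jF; have /= := wAB j; rewrite inE jF ?orbT => /(_ isT)[//].
Qed.

Lemma cylinders_measurable (J : set I) (E : set T) :
  <<s cylinders J >> E -> measurable E.
Proof.
apply: smallest_sub; first exact: sigma_algebra_measurable.
move=> _ [F [A [_ mA ->]]]; apply: fin_bigcap_measurable => // j _.
by rewrite -[_ @^-1` _]setTI; exact: measurable_funP.
Qed.

(** This says that [f] depends only on the variables in [J]. As measurability over a generated
    sigma-algebra, it inherits the closure properties under sums and pairs. *)
Definition generated_measurable (J : set I) d1 (T1 : measurableType d1)
    (f : T -> T1) : Prop :=
  measurable_fun [set: g_sigma_algebraType (cylinders J)] f.

Lemma generated_measurableW (J : set I) d1 (T1 : measurableType d1)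
    (f : T -> T1) : generated_measurable J f -> measurable_fun setT f.
Proof.
by move=> mf _ A mA; apply: (@cylinders_measurable J); exact: mf.
Qed.

Lemma generated_measurable_coord (J : set I) (i : I) :
  J i -> generated_measurable J (X i).
Proof.
move=> Ji _ A mA; rewrite setTI; apply: sub_sigma_algebra.
exists [fset i]%fset, (fun=> A); split=> //.
  by move=> j /=; rewrite inE => /eqP ->.
apply/seteqP; split=> [w wA j /=|w].
  by rewrite inE => /eqP ->.
by apply; rewrite /= inE.
Qed.

Hypothesis indep : mutually_independent X.

(** The finite index sets are disjoint, so the two families glue to a single cylinder [C] over their
    union, whose product splits along the two sets. *)
Lemma cylinders_independent (J K : set I) (E F : set T) : J `&` K = set0 ->
  cylinders J E -> cylinders K F -> (P (E `&` F) = P E * P F)%E.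
Proof.
move=> JK [F1 [A [FJ mA ->]]] [F2 [B [GJ mB ->]]].
rewrite (indep F1 mA) (indep F2 mB).
have dF j : j \in F2 -> j \in F1 = false.
  move=> j2; apply/negP => j1; suff : (J `&` K) j by rewrite JK.
  by split; [exact: FJ|exact: GJ].
pose C j := if j \in F1 then A j else B j.
have mC j : measurable (C j) by rewrite /C; case: ifP.
have -> : (\bigcap_(j in [set` F1]) (X j @^-1` A j)) `&`
    (\bigcap_(j in [set` F2]) (X j @^-1` B j)) =
    \bigcap_(j in [set` (F1 `|` F2)%fset]) (X j @^-1` C j).
  apply/seteqP; split=> [w [wA wB] j /=|w wAB].
    rewrite inE /C; case: ifPn => [/wA //|_ /= /wB //].
  split=> j /= jF; have /= := wAB j; rewrite inE /C ?jF ?orbT ?dF//.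
    by apply.
  by apply.
rewrite (indep _ mC) (big_fsetID _ (mem F1))/=; congr (_ * _)%E.
  rewrite [in RHS]big_seq [in LHS](_ : [fset x | x in _ & _]%fset = F1).
    by rewrite big_seq; apply: eq_bigr => j jF; rewrite /C jF.
  by apply/fsetP => j; rewrite !inE andbC; case: (j \in F1).
rewrite [in RHS]big_seq [in LHS](_ : [fset x | x in _ & _]%fset = F2).
  by rewrite big_seq; apply: eq_bigr => j jF; rewrite /C dF.
apply/fsetP => j; rewrite !inE; have := dF j.
by case: (j \in F1); case: (j \in F2) => // /(_ isT).
Qed.

(** Proper differences follow from additivity of the finite measure [P], increasing unions from
    continuity from below. *)
Lemma independent_lambda_system (E : set T) : measurable E ->
  lambda_system setT [set A | measurable A /\ (P (A `&` E) = P A * P E)%E].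
Proof.
move=> mE; split=> //.
- by split=> //; rewrite setTI probability_setT mul1e.
- move=> A B BA [mA PA] [mB PB]; split; first exact: measurableD.
  rewrite setIDAC setIDA measureD//; [|exact: measurableI|].
    rewrite setIAC (setIidr BA).
    transitivity (P A * P E - P B * P E)%E; first by rewrite -PA -PB.
    rewrite measureD//; last first.
      by rewrite -ge0_fin_numE// fin_num_measure.
    rewrite (setIidr BA); apply/esym/muleBl; first exact: fin_num_measure.
    by apply: fin_num_adde_defr; exact: fin_num_measure.
  by rewrite -ge0_fin_numE// fin_num_measure//; exact: measurableI.
- move=> F ndF FE; split.
    by apply: bigcup_measurable => k _; exact: (FE k).1.
  have mF k : measurable (F k) by exact: (FE k).1.
  have c1 : P (F n `&` E) @[n --> \oo] --> P (\bigcup_n (F n `&` E)).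
    apply: nondecreasing_cvg_mu.
    - by move=> i; exact: measurableI.
    - by apply: bigcup_measurable => k _; exact: measurableI.
    - by move=> m n mn; apply/subsetPset; apply: setSI; apply/subsetPset/ndF.
  have c2 : (P (F n) * P E)%E @[n --> \oo] --> (P (\bigcup_n F n) * P E)%E.
    apply: cvgeZr; first exact: fin_num_measure.
    by apply: nondecreasing_cvg_mu => //; exact: bigcup_measurable.
  rewrite setI_bigcupl.
  rewrite -(cvg_lim _ c1)// -(cvg_lim _ c2)//; congr (lim (_ @ \oo)).
  by apply/funext => n /=; exact: (FE n).2.
Qed.

(** The pi-lambda theorem is applied twice: first on the side of [K] against a fixed cylinder over
    [J], then on the side of [J] against the fixed set [F]. *)
Lemma sigma_cylinders_independent (J K : set I) (E F : set T) :
  J `&` K = set0 -> <<s cylinders J >> E -> <<s cylinders K >> F ->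
  (P (E `&` F) = P E * P F)%E.
Proof.
move=> JK sE sF.
have cyl L C : cylinders L C -> measurable C.
  by move=> LC; apply: (@cylinders_measurable L); exact: sub_sigma_algebra.
have cF E' : cylinders J E' -> (P (E' `&` F) = P E' * P F)%E.
  move=> cE; rewrite setIC muleC.
  suff : <<s cylinders K >> `<=`
      [set A | measurable A /\ (P (A `&` E') = P A * P E')%E].
    by move=> /(_ F sF)[].
  apply: lambda_system_subset => //.
  - exact: cylinders_setI_closed.
  - exact: (independent_lambda_system (cyl _ _ cE)).
  - move=> F' cF' /=; split; first exact: cyl cF'.
    by rewrite setIC muleC; exact: cylinders_independent cE cF'.
suff : <<s cylinders J >> `<=`
    [set A | measurable A /\ (P (A `&` F) = P A * P F)%E].
  by move=> /(_ E sE)[].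
apply: lambda_system_subset => //.
- exact: cylinders_setI_closed.
- exact: (independent_lambda_system (cylinders_measurable sF)).
- by move=> E' cE' /=; split; [exact: cyl cE'|exact: cF].
Qed.

Lemma generated_independent (J K : set I) d1 (T1 : measurableType d1)
    d2 (T2 : measurableType d2) (f : T -> T1) (g : T -> T2) :
  J `&` K = set0 -> generated_measurable J f -> generated_measurable K g ->
  independent_functions f g.
Proof.
move=> JK mf mg A B mA mB; apply: (sigma_cylinders_independent JK).
  by rewrite -[_ @^-1` _]setTI; exact: mf.
by rewrite -[_ @^-1` _]setTI; exact: mg.
Qed.

End independence.

(** * Integrals of functions of independent variables *)

Section laws.
Context (d : measure_display) (T : measurableType d) (R : realType)
  (P : probability T R) (d1 : measure_display) (T1 : measurableType d1).

Definition same_law (X X' : T -> T1) : Prop :=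
  forall A, measurable A -> P (X @^-1` A) = P (X' @^-1` A).

Lemma same_law_integral (X X' : T -> T1) (f : T1 -> \bar R) :
  measurable_fun setT X -> measurable_fun setT X' -> same_law X X' ->
  measurable_fun setT f -> (forall x, 0 <= f x)%E ->
  (\int[P]_w f (X w) = \int[P]_w f (X' w))%E.
Proof.
move=> mX mX' XX' mf f0.
have E (Y : T -> T1) (mY : measurable_fun setT Y) :
    (\int[distribution P (mfun_Sub (mem_set mY))]_y f y = \int[P]_w f (Y w))%E.
  by rewrite ge0_integral_distribution.
rewrite -(E _ mX) -(E _ mX'); apply: eq_measure_integral => A mA _.
exact: XX'.
Qed.

Context (d2 : measure_display) (T2 : measurableType d2).

(** The law of the pair agrees with the product of the two laws on rectangles, hence everywhere;
    Tonelli then integrates over [X] with [Y] frozen. *)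
Lemma independent_integral (X : T -> T1) (Y : T -> T2)
    (f : T1 * T2 -> \bar R) :
  measurable_fun setT X -> measurable_fun setT Y ->
  independent_functions P X Y ->
  measurable_fun setT f -> (forall x, 0 <= f x)%E ->
  (\int[P]_w f (X w, Y w) = \int[P]_w \int[P]_w' f (X w', Y w))%E.
Proof.
move=> mX mY XY mf f0.
have mXY : measurable_fun setT (fun w => (X w, Y w)).
  exact: measurable_fun_pair.
pose X' : {mfun T >-> T1} := mfun_Sub (mem_set mX).
pose Y' : {mfun T >-> T2} := mfun_Sub (mem_set mY).
pose Z' : {mfun T >-> (T1 * T2)%type} := mfun_Sub (mem_set mXY).
have prodE C : measurable C ->
    (distribution P X' \x distribution P Y')%E C = distribution P Z' C.
  apply: product_measure_unique => A B mA mB.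
  exact: XY.
transitivity (\int[distribution P Z']_z f z)%E.
  by rewrite ge0_integral_distribution.
transitivity (\int[(distribution P X' \x distribution P Y')%E]_z f z)%E.
  by apply: eq_measure_integral => C mC _; exact/esym/prodE.
rewrite fubini_tonelli2// ge0_integral_distribution//=.
- apply: eq_integral => w _; rewrite /fubini_G/= ge0_integral_distribution//.
  exact: measurableT_comp.
- exact: measurable_fun_fubini_tonelli_G.
- by move=> y; apply: integral_ge0.
Qed.

Lemma independent_integralM (X : T -> T1) (Y : T -> T2)
    (f : T1 -> \bar R) (g : T2 -> \bar R) :
  measurable_fun setT X -> measurable_fun setT Y ->
  independent_functions P X Y ->
  measurable_fun setT f -> (forall x, 0 <= f x)%E ->
  measurable_fun setT g -> (forall x, 0 <= g x)%E ->
  (\int[P]_w (f (X w) * g (Y w)) = \int[P]_w f (X w) * \int[P]_w g (Y w))%E.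
Proof.
move=> mX mY XY mf f0 mg g0.
rewrite (independent_integral mX mY XY (f := fun z => (f z.1 * g z.2)%E))/=.
- rewrite -ge0_integralZl//.
  + apply: eq_integral => w _; rewrite -ge0_integralZr//.
    exact: measurableT_comp.
  + exact: measurableT_comp.
  + exact: integral_ge0.
- by apply: emeasurable_funM; exact: measurableT_comp.
- by move=> z; exact: mule_ge0.
Qed.

(** Allows an individual service time to be replaced by the generic one of its queue. *)
Lemma same_law_pair_integral (X X' : T -> T1) (Y : T -> T2)
    (f : T1 * T2 -> \bar R) :
  measurable_fun setT X -> measurable_fun setT X' -> measurable_fun setT Y ->
  independent_functions P X Y -> independent_functions P X' Y ->
  same_law X X' ->
  measurable_fun setT f -> (forall x, 0 <= f x)%E ->
  (\int[P]_w f (X w, Y w) = \int[P]_w f (X' w, Y w))%E.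
Proof.
move=> mX mX' mY XY X'Y XX' mf f0; rewrite !independent_integral//.
apply: eq_integral => w _.
apply: (same_law_integral (f := fun x => f (x, Y w))) => //.
exact: measurableT_comp.
Qed.

End laws.

(** * Erlang distribution functions *)

Section truncated_exponential.
Context (R : realType).
Implicit Types (x : R) (n k : nat).

(** The sum has [n] terms, so it is 0 for [n = 0], and differentiation lowers [n] by one. *)
Definition exp_trunc n x : R := \sum_(i < n) x ^+ i / i`!%:R.

Lemma exp_truncS n x : exp_trunc n.+1 x = exp_trunc n x + x ^+ n / n`!%:R.
Proof. by rewrite /exp_trunc big_ord_recr. Qed.

Lemma exp_term_rec n x :
  x * (x ^+ n / n`!%:R) = n.+1%:R * (x ^+ n.+1 / n.+1`!%:R).
Proof.
rewrite factS natrM exprS; field.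
by rewrite nat1r pnatr_eq0 -lt0n fact_gt0 pnatr_eq0.
Qed.

Lemma exp_truncS0 n : exp_trunc n.+1 0 = 1.
Proof.
rewrite /exp_trunc big_ord_recl big1 ?addr0 ?expr0 ?fact0 ?divr1// => i _.
by rewrite expr0n/= mul0r.
Qed.

Lemma is_derive_exp_trunc n x :
  is_derive x 1 (exp_trunc n.+1) (exp_trunc n x).
Proof.
elim: n => [|n IH].
  have -> : exp_trunc 1 = cst 1.
    by apply/funext => z; rewrite /exp_trunc big_ord1 expr0 fact0 divr1.
  by rewrite /exp_trunc big_ord0; exact: is_derive_cst.
have -> : exp_trunc n.+2 =
    exp_trunc n.+1 + (n.+1`!%:R^-1 \*: ((@id R) ^+ n.+1)).
  by apply/funext => z; rewrite exp_truncS fctE exprfctE /= mulrC.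
rewrite exp_truncS; apply: is_deriveD; apply: is_derive_eq.
rewrite /GRing.scale/= factS natrM; field.
by rewrite nat1r pnatr_eq0 -lt0n fact_gt0 pnatr_eq0.
Qed.

Lemma exp_trunc_series n x : exp_trunc n x = series (exp_coeff x) n.
Proof. by rewrite /exp_trunc /series/= big_mkord. Qed.

Lemma cvg_exp_trunc x : exp_trunc n x @[n --> \oo] --> expR x.
Proof.
rewrite (_ : (fun n => _) = series (exp_coeff x)).
  exact: is_cvg_series_exp_coeff.
by apply/funext => n; exact: exp_trunc_series.
Qed.

Lemma exp_trunc_le n x : 0 <= x -> exp_trunc n x <= expR x.
Proof.
move=> x0; have cx : cvgn (exp_trunc ^~ x).
  by apply/cvg_ex; exists (expR x); exact: cvg_exp_trunc.
rewrite -(cvg_lim _ (cvg_exp_trunc (x := x)))//.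
apply: (nondecreasing_cvgn_le _ cx); apply/nondecreasing_seqP => k.
by rewrite exp_truncS lerDl divr_ge0 ?exprn_ge0.
Qed.

(** Termwise, [x] times the term of degree [i] is [i.+1] times the next one, and [i >= n] in the
    tail. The finite tails are compared by induction on [k], then [k] goes to infinity. *)
Lemma exp_tail_le n x : 0 <= x ->
  n.+1%:R * (expR x - exp_trunc n.+1 x) <= x * (expR x - exp_trunc n x).
Proof.
move=> x0.
have le k : n.+1%:R * (exp_trunc (n + k).+1 x - exp_trunc n.+1 x) <=
    x * (exp_trunc (n + k) x - exp_trunc n x).
  elim: k => [|k IH]; first by rewrite addn0 !subrr !mulr0.
  rewrite addnS (exp_truncS (n + k).+1) [in leRHS]exp_truncS.
  rewrite ![_ + _ - _]addrAC (mulrDr n.+1%:R) (mulrDr x).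
  rewrite exp_term_rec lerD//.
  rewrite ler_wpM2r ?ler_nat//; last by rewrite ltnS leq_addr.
  by rewrite divr_ge0 ?exprn_ge0.
have c1 : n.+1%:R * (exp_trunc (n + k).+1 x - exp_trunc n.+1 x) @[k --> \oo] -->
    n.+1%:R * (expR x - exp_trunc n.+1 x).
  apply: cvgMr; apply: cvgB; last exact: cvg_cst.
  have := cvg_exp_trunc (x := x); rewrite -(cvg_shiftn n.+1).
  by under eq_fun do rewrite addnC addSn.
have c2 : x * (exp_trunc (n + k) x - exp_trunc n x) @[k --> \oo] -->
    x * (expR x - exp_trunc n x).
  apply: cvgMr; apply: cvgB; last exact: cvg_cst.
  have := cvg_exp_trunc (x := x); rewrite -(cvg_shiftn n).
  by under eq_fun do rewrite addnC.
by apply: ler_cvg_to c1 c2 _; exact: nearW.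
Qed.

(** The summands are the probabilities that a Poisson variable of mean [x] exceeds [k]; both sides
    are the mean of that variable capped at [n.+1]. *)
Lemma sum_exp_tail n x :
  \sum_(0 <= k < n.+1) (1 - expR (- x) * exp_trunc k.+1 x) =
  n.+1%:R * (1 - expR (- x) * exp_trunc n.+1 x) + expR (- x) * x * exp_trunc n x.
Proof.
elim: n => [|n IH].
  by rewrite big_nat1 /exp_trunc big_ord0 mulr0 addr0 mul1r.
rewrite big_nat_recr//= IH !(exp_truncS n.+1).
have := exp_term_rec n x; have := exp_truncS n x.
move: (x ^+ n / _) (x ^+ n.+1 / _) (exp_trunc n.+1 x) (exp_trunc n x) => t u b a.
move=> -> tu; apply/eqP; rewrite -subr_eq0; apply/eqP.
transitivity (expR (- x) * (n.+1%:R * u - x * t)); last by rewrite tu subrr mulr0.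
by ring.
Qed.

(** The mean of a Poisson variable as the sum of its tail probabilities. *)
Lemma cvg_sum_exp_tail x : 0 <= x ->
  \sum_(0 <= k < n) (1 - expR (- x) * exp_trunc k.+1 x) @[n --> \oo] --> x.
Proof.
move=> x0; rewrite -(cvg_shiftn 1)/=.
under eq_fun do rewrite addn1 sum_exp_tail.
have E : expR (- x) * expR x = 1 by rewrite -expRD addNr expR0.
have c0 : expR (- x) * x * exp_trunc n x @[n --> \oo] --> x.
  have : expR (- x) * x * exp_trunc n x @[n --> \oo] --> expR (- x) * x * expR x.
    by apply: cvgMr; exact: cvg_exp_trunc.
  by rewrite mulrAC E mul1r.
(* The boundary term is squeezed to 0: by [exp_tail_le] it is at most [x] minus the other term,
   which tends to [x]. *)
have c1 : n.+1%:R * (1 - expR (- x) * exp_trunc n.+1 x) @[n --> \oo] --> (0 : R).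
  apply: (@squeeze_cvgr _ _ _ _ (cst 0)
    (fun n => x - expR (- x) * x * exp_trunc n x)).
  - apply: nearW => n /=; apply/andP; split.
      rewrite mulr_ge0// subr_ge0 -E ler_pM2l ?expR_gt0//; exact: exp_trunc_le.
    have := exp_tail_le n x0; rewrite -(ler_pM2l (expR_gt0 (- x))).
    rewrite mulrCA !mulrBr [expR (- x) * (x * expR x)]mulrCA E !mulr1.
    by rewrite (mulrA (expR _) x).
  - exact: cvg_cst.
  - have : x - expR (- x) * x * exp_trunc n x @[n --> \oo] --> x - x.
      by apply: cvgB => //; exact: cvg_cst.
    by rewrite subrr.
have : n.+1%:R * (1 - expR (- x) * exp_trunc n.+1 x) +
    expR (- x) * x * exp_trunc n x @[n --> \oo] --> 0 + x by exact: cvgD c1 c0.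
by rewrite add0r.
Qed.

End truncated_exponential.

(** * Convolution recursion and sum of the distribution functions *)

Section erlang.
Context (R : realType).
Implicit Types (lam x y : R) (j : nat).
Notation mu := (@lebesgue_measure R).

(** For [j = 0] this is the distribution function of the unit mass at 0, which starts the recursion
    and also describes the customers present initially. *)
Definition erlang_cdf lam j y : R :=
  if y < 0 then 0 else 1 - expR (- lam * y) * exp_trunc j (lam * y).

Lemma continuous_exp_trunc j : continuous (@exp_trunc R j).
Proof.
case: j => [|j] x.
  rewrite (_ : exp_trunc 0 = cst 0); first exact: cvg_cst.
  by apply/funext => z; rewrite /exp_trunc big_ord0.
apply/differentiable_continuous/derivable1_diffP.
by have [] := is_derive_exp_trunc j x.
Qed.

(** A primitive of the convolution integrand on [[0, y]]: there the two exponentials multiply to the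
    constant [expR (- lam * y)], so only [exp_trunc] is left to integrate. *)
Lemma erlang_primitive lam j y x :
  is_derive x 1
    (fun z => - expR (- lam * z) +
       expR (- lam * y) * exp_trunc j.+1 (lam * (y - z)))
    (lam * expR (- lam * x) -
       lam * (expR (- lam * y) * exp_trunc j (lam * (y - x)))).
Proof.
have d1 := is_deriveN (is_derive1_comp (is_derive_expR _)
  (is_deriveZ (- lam) (is_derive_id x (1 : R)))).
have d2 := is_deriveZ (expR (- lam * y)) (@is_derive1_comp _
  (exp_trunc j.+1) (lam \*: (cst y - id)) x _ _ (is_derive_exp_trunc j _)
  (is_deriveZ lam (is_deriveB (is_derive_cst y x (1 : R)) (is_derive_id x (1 : R))))).
apply: (is_derive_eq (is_deriveD d1 d2)).
by rewrite /GRing.scale/=; ring.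
Qed.

Lemma erlang_cdf_rec lam j y : 0 < lam ->
  (\int[mu]_x ((exponential_pdf lam x)%:E * (erlang_cdf lam j (y - x))%:E) =
   (erlang_cdf lam j.+1 y)%:E)%E.
Proof.
move=> lam0.
have [y0|y0] := ltP y 0.
  rewrite /erlang_cdf y0 integral0_eq// => x _.
  have [x0|x0] := ltP x 0; first by rewrite lt0_exponential_pdf// mul0e.
  by rewrite ifT ?mule0// subr_lt0 (lt_le_trans y0).
pose G x := lam * expR (- lam * x) -
  lam * (expR (- lam * y) * exp_trunc j (lam * (y - x))).
(* Left of 0 the density vanishes, right of [y] the distribution function does. *)
have -> : (\int[mu]_x ((exponential_pdf lam x)%:E *
    (erlang_cdf lam j (y - x))%:E) = \int[mu]_(x in `[0%R, y]) (G x)%:E)%E.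
  rewrite [RHS]integral_mkcond; apply: eq_integral => x _.
  rewrite patchE mem_setE in_itv/=.
  have [x0|x0] := ltP x 0; first by rewrite lt0_exponential_pdf// mul0e.
  have [xy|xy] := leP x y; last first.
    by rewrite /erlang_cdf ifT ?mule0// subr_lt0.
  rewrite /erlang_cdf ltNge subr_ge0 xy/= exponential_pdfE//.
  rewrite -EFinM mulrBr mulr1 mulrA -[lam * _ * _]mulrA -expRD; congr (_ - _)%:E.
  by rewrite mulrA; congr (_ * expR _ * _); ring.
have cG : continuous G.
  move=> x; apply: cvgB; apply: cvgMr.
    apply: continuous_comp; last exact: continuous_expR.
    by apply: cvgMr; exact: cvg_id.
  apply: cvgMr; apply: continuous_comp; last exact: continuous_exp_trunc.
  by apply: cvgMr; apply: cvgB; [exact: cvg_cst|exact: cvg_id].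
have dF x := erlang_primitive lam j y x.
have E0 : expR (- lam * y) * exp_trunc j.+1 (lam * (y - y)) = expR (- lam * y).
  by rewrite subrr mulr0 exp_truncS0 mulr1.
(* The fundamental theorem is applied on a nondegenerate interval; at [y = 0] both sides are 0. *)
move: y0; rewrite le_eqVlt => /predU1P[y0|y0].
  rewrite -y0 set_itv1 integral_set1 /erlang_cdf ltxx !mulr0 expR0.
  by rewrite exp_truncS0 mul1r subrr.
rewrite (continuous_FTC2 (F := fun z => - expR (- lam * z) +
       expR (- lam * y) * exp_trunc j.+1 (lam * (y - z)))) //.
- rewrite E0 addNr mulr0 expR0 subr0 -EFinB /erlang_cdf ltNge (ltW y0)/=.
  by rewrite sub0r opprD opprK.
- exact: continuous_subspaceT.
- have cF : continuous (fun z => - expR (- lam * z) +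
       expR (- lam * y) * exp_trunc j.+1 (lam * (y - z))).
    by move=> x; apply/differentiable_continuous/derivable1_diffP; have [] := dF x.
  split.
  + by move=> x _; have [] := dF x.
  + by apply: cvg_at_right_filter; exact: cF.
  + by apply: cvg_at_left_filter; exact: cF.
- by move=> x _; rewrite derive1E; have [] := dF x.
Qed.

Lemma erlang_cdf0 lam y : erlang_cdf lam 0 y = if y < 0 then 0 else 1.
Proof. by rewrite /erlang_cdf /exp_trunc big_ord0 mulr0 subr0. Qed.

Lemma erlang_cdf_ge0 lam j y : 0 < lam -> 0 <= erlang_cdf lam j y.
Proof.
move=> lam0; rewrite /erlang_cdf; case: ltP => // y0.
have ly0 : 0 <= lam * y by rewrite mulr_ge0// ltW.
rewrite subr_ge0 mulNr -(ler_pM2l (expR_gt0 (lam * y))) mulrA -expRD subrr.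
by rewrite expR0 mul1r mulr1 exp_trunc_le.
Qed.

Lemma sum_erlang_cdf lam y : 0 < lam -> 0 <= y ->
  (\sum_(0 <= k <oo) (erlang_cdf lam k.+1 y)%:E = (lam * y)%:E)%E.
Proof.
move=> lam0 y0; apply/cvg_lim => //.
have : (\sum_(0 <= k < n) (1 - expR (- (lam * y)) * exp_trunc k.+1 (lam * y)))%:E
    @[n --> \oo] --> (lam * y)%:E.
  apply: cvg_EFin; first exact: nearW.
  by apply: cvg_sum_exp_tail; rewrite mulr_ge0// ltW.
rewrite (_ : (fun n => _%:E) =
    (fun n => \sum_(0 <= k < n) (erlang_cdf lam k.+1 y)%:E)%E)//.
apply/funext => n; rewrite -sumEFin; apply: eq_bigr => k _.
by rewrite /erlang_cdf ltNge y0 mulNr.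
Qed.

End erlang.

(** * Completions at one queue *)

(** Sign conditions on the inputs hold only almost surely; this lets an equality of integrands be
    proved pointwise under such a condition [h]. *)
Lemma ae_integral_eq d (T : measurableType d) (R : realType)
  (P : probability T R) (h : T -> Prop) (f g : T -> \bar R) :
  measurable_fun [set: T] f -> measurable_fun [set: T] g ->
  (forall w, 0 <= f w)%E -> (forall w, 0 <= g w)%E ->
  {ae P, forall w, h w} -> (forall w, h w -> f w = g w) ->
  (\int[P]_w f w = \int[P]_w g w)%E.
Proof.
move=> mf mg f0 g0 ph hfg; apply: ge0_ae_eq_integral => //.
case: ph => N [mN N0 hN]; exists N; split => //.
move=> w /= nfg; apply: hN => /= hw; apply: nfg => _; exact: hfg.
Qed.

Section queue.
Context (d : measure_display) (T : measurableType d) (R : realType)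
  (P : probability T R).
Notation mu := (@lebesgue_measure R).

Lemma measurable_bool_natr d' (T' : measurableType d') (b : T' -> bool) :
  measurable_fun [set: T'] b ->
  measurable_fun [set: T'] (fun w => (b w)%:R : R).
Proof.
move=> mb; rewrite (_ : (fun w => _) = (fun w => if b w then 1 else 0)).
  exact: measurable_fun_ifT.
by apply/funext => w; case: (b w).
Qed.

Lemma measurable_bool_EFin d' (T' : measurableType d') (b : T' -> bool) :
  measurable_fun [set: T'] b ->
  measurable_fun [set: T'] (fun w => ((b w)%:R : R)%:E).
Proof. by move=> mb; apply/measurable_EFinP; exact: measurable_bool_natr. Qed.

Lemma integral_bool (b : T -> bool) : measurable_fun [set: T] b ->
  (\int[P]_w ((b w)%:R : R)%:E = P [set w | b w])%E.
Proof.
move=> mb.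
have mE : measurable [set w | b w].
  by rewrite -[X in measurable X]setTI; exact: mb.
transitivity (\int[P]_w (\1_[set w | b w] w)%:E)%E.
  by apply: eq_integral => w _; rewrite indicE mem_setE.
by rewrite integral_indic// setIT.
Qed.

Lemma exponential_cdf (U : T -> R) (lam t : R) :
  measurable_fun [set: T] U ->
  (forall A, measurable A -> P (U @^-1` A) = exponential_prob lam A) ->
  (\int[P]_w ((U w <= t)%R%:R : R)%:E =
   \int[mu]_x ((exponential_pdf lam x)%:E * ((x <= t)%R%:R)%:E))%E.
Proof.
move=> mU Ulaw; rewrite integral_bool; last by apply: measurable_fun_ler.
have -> : [set w | U w <= t] = U @^-1` `]-oo, t].
  by apply/seteqP; split=> w /=; rewrite in_itv.
rewrite Ulaw// /exponential_prob integral_mkcond; apply: eq_integral => x _.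
by rewrite patchE mem_setE in_itv/=; case: leP; rewrite ?mule1 ?mule0.
Qed.

(** With [A] frozen, the integral over [U] becomes one against the density; Tonelli then moves the
    density outside. *)
Lemma exponential_convolution (A U : T -> R) (lam y : R) : 0 < lam ->
  measurable_fun [set: T] A -> measurable_fun [set: T] U ->
  independent_functions P U A ->
  (forall B, measurable B -> P (U @^-1` B) = exponential_prob lam B) ->
  (\int[P]_w ((A w + U w <= y)%R%:R : R)%:E =
   \int[mu]_x ((exponential_pdf lam x)%:E *
               \int[P]_w ((A w <= y - x)%R%:R)%:E))%E.
Proof.
move=> lam0 mA mU UA Ulaw.
pose f (z : R * R) : \bar R := ((z.2 <= y - z.1)%R%:R)%:E.
have mf : measurable_fun setT f.
  apply: measurable_bool_EFin; apply: measurable_fun_ler => //.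
  by apply: measurable_funB.
transitivity (\int[P]_w f (U w, A w))%E.
  by apply: eq_integral => w _; rewrite /f/= lerBrDr.
rewrite independent_integral//; last by move=> z; rewrite lee_fin.
pose g (z : T * R) : \bar R :=
  ((exponential_pdf lam z.2)%:E * ((A z.1 <= y - z.2)%R%:R)%:E)%E.
have mg : measurable_fun setT g.
  apply: emeasurable_funM.
    apply/measurable_EFinP; apply: measurableT_comp => //.
    exact: measurable_exponential_pdf.
  apply: measurable_bool_EFin; apply: measurable_fun_ler.
    exact: measurableT_comp.
  by apply: measurable_funB.
transitivity (\int[P]_w \int[mu]_x g (w, x))%E.
  apply: eq_integral => w _; rewrite /f /g/=.
  under eq_integral do rewrite lerBrDr addrC -lerBrDr.
  rewrite (exponential_cdf _ mU Ulaw); apply: eq_integral => x _.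
  by rewrite lerBrDr addrC -lerBrDr.
transitivity (\int[mu]_x \int[P]_w g (w, x))%E.
  apply: (@fubini_tonelli _ _ _ _ _ P mu g) => // z.
  by rewrite mule_ge0// lee_fin// exponential_pdf_ge0// ltW.
apply: eq_integral => x _; rewrite -ge0_integralZl//.
  apply: measurable_bool_EFin; exact: measurable_fun_ler.
by rewrite lee_fin exponential_pdf_ge0// ltW.
Qed.

(** Induction on [j]: the newest summand is independent of the earlier sum, so the convolution
    recursion applies. *)
Lemma erlang_sum (U : nat -> T -> R) (lam : R) (j : nat) (y : R) : 0 < lam ->
  (forall k, measurable_fun [set: T] (U k)) ->
  (forall k, independent_functions P (U k) (fun w => \sum_(i < k) U i w)) ->
  (forall k B, measurable B -> P (U k @^-1` B) = exponential_prob lam B) ->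
  (\int[P]_w ((\sum_(k < j) U k w <= y)%R%:R : R)%:E =
   (erlang_cdf lam j y)%:E)%E.
Proof.
move=> lam0 mU indU Ulaw; elim: j y => [|j IH] y.
  under eq_integral do rewrite big_ord0.
  rewrite integral_cst// [X in (_ * X)%E](_ : _ = 1%E); last exact: probability_setT.
  by rewrite mule1 erlang_cdf0; case: ltP.
under eq_integral do rewrite big_ord_recr/=.
rewrite (exponential_convolution (A := fun w => \sum_(i < j) U i w) _ lam0)//;
  [|exact: measurable_sum|exact: Ulaw].
rewrite -erlang_cdf_rec//; apply: eq_integral => x _.
by rewrite IH.
Qed.

Lemma measurable_erlang_cdf (lam : R) j :
  measurable_fun [set: R] (erlang_cdf lam j).
Proof.
apply: measurable_fun_ifT => //; first exact: measurable_fun_ltr.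
apply: continuous_measurable_fun => x; apply: cvgB; first exact: cvg_cst.
apply: cvgM; apply: continuous_comp.
- by apply: cvgMr; exact: cvg_id.
- exact: continuous_expR.
- by apply: cvgMr; exact: cvg_id.
- exact: continuous_exp_trunc.
Qed.

(** The maximum splits into a condition free of [a] and a threshold for [a]; since [b >= 0], the
    threshold implies [a <= s + v]. *)
Lemma completesE (a s v b : R) : 0 <= b ->
  completes a s v b = (b <= v) && (a <= s + v - b).
Proof.
move=> b0; rewrite /completes.
by case: (leP a s) => as'; apply/idP/idP => /andP[le1 le2];
  apply/andP; split; lra.
Qed.

(* The subtraction is truncated: the sum is empty, hence 0, for the n i customers
   present initially. *)
Lemma arrival_timeE (N : nat) (U : 'I_N -> nat -> {RV P >-> R})
    (n : 'I_N -> nat) (i : 'I_N) (l : nat) (w : T) :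
  arrival_time U n i l w = \sum_(k < l.+1 - n i) U i k w.
Proof.
rewrite /arrival_time; case: ltnP => ln; last by rewrite subSn.
by move: ln; rewrite -subn_eq0 => /eqP ->; rewrite big_ord0.
Qed.

(** For [l < n] the truncated difference is 0 and the term is 1; the remaining terms form the
    unshifted series. *)
Lemma sum_shifted_erlang_cdf (lam y : R) (n : nat) : 0 < lam -> 0 <= y ->
  (\sum_(0 <= l <oo) (erlang_cdf lam (l.+1 - n) y)%:E = (n%:R + lam * y)%:E)%E.
Proof.
move=> lam0 y0.
have e0 k : (0 <= (erlang_cdf lam k y)%:E)%E by rewrite lee_fin erlang_cdf_ge0.
rewrite (nneseries_split 0 n)// add0n EFinD; congr (_ + _)%E.
  rewrite big_mkord (eq_bigr (fun=> 1%E)).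
    by rewrite sumEFin sumr_const card_ord.
  move=> l _; have /eqP -> : (l.+1 - n == 0)%N by rewrite subn_eq0.
  by rewrite erlang_cdf0 ltNge y0.
rewrite -sum_erlang_cdf// -(nneseries_addn n)//.
by apply: eq_eseriesr => k _; rewrite -addSn addnK.
Qed.

(** * One visit, with entry time [s], duration [v] and generic service time [b] *)

Section completions.
Variables (A S : nat -> T -> R) (s v b : T -> R) (lam : R) (n : nat).
Hypotheses (lam_gt0 : 0 < lam)
  (mA : forall l, measurable_fun [set: T] (A l))
  (mS : forall l, measurable_fun [set: T] (S l))
  (ms : measurable_fun [set: T] s) (mv : measurable_fun [set: T] v)
  (mb : measurable_fun [set: T] b).
Hypotheses (s_ge0 : {ae P, forall w, 0 <= s w})
  (S_ge0 : forall l, {ae P, forall w, 0 <= S l w}).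
Hypotheses (A_law : forall l y,
    (\int[P]_w ((A l w <= y)%R%:R : R)%:E = (erlang_cdf lam (l.+1 - n) y)%:E)%E)
  (S_law : forall l, same_law P (S l) b).
Hypotheses
  (A_indep : forall l,
    independent_functions P (A l) (fun w => (S l w, (s w, v w))))
  (S_indep : forall l, independent_functions P (S l) (fun w => (s w, v w)))
  (b_indep : independent_functions P b (fun w => (s w, v w)))
  (s_indep : independent_functions P s (fun w => (b w, v w))).

Lemma measurable_completes (l : nat) : measurable_fun [set: T]
  (fun w => ((completes (A l w) (s w) (v w) (S l w))%:R : R)%:E).
Proof.
apply: measurable_bool_EFin.
apply: measurable_and; apply: measurable_fun_ler => //.
- exact: measurable_funD.
- by apply: measurable_funD => //; exact: measurable_maxr.
- exact: measurable_funD.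
Qed.

(** The arrival time is integrated out first, which gives its distribution function at the
    threshold. Then [S l] is exchanged for [b]: they have the same law and both are independent of
    [(s, v)]. *)
Lemma completion_prob (l : nat) :
  (\int[P]_w ((completes (A l w) (s w) (v w) (S l w))%:R : R)%:E =
   \int[P]_w ((b w <= v w)%R%:R * erlang_cdf lam (l.+1 - n) (s w + v w - b w))%:E)%E.
Proof.
pose g (z : R * (R * (R * R))) : \bar R :=
  (((z.2.1 <= z.2.2.2) && (z.1 <= z.2.2.1 + z.2.2.2 - z.2.1))%R%:R)%:E.
have m1 : measurable_fun setT (fun z : R * (R * (R * R)) => z.2.1).
  exact: measurableT_comp.
have m21 : measurable_fun setT (fun z : R * (R * (R * R)) => z.2.2.1).
  by apply: measurableT_comp => //; exact: measurableT_comp.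
have m22 : measurable_fun setT (fun z : R * (R * (R * R)) => z.2.2.2).
  by apply: measurableT_comp => //; exact: measurableT_comp.
have mg : measurable_fun setT g.
  apply: measurable_bool_EFin; apply: measurable_and.
    exact: measurable_fun_ler.
  apply: measurable_fun_ler => //; apply: measurable_funB => //.
  exact: measurable_funD.
have msv : measurable_fun setT (fun w => (s w, v w)).
  exact: measurable_fun_pair.
have mX : measurable_fun setT (fun w => (S l w, (s w, v w))).
  exact: measurable_fun_pair.
transitivity (\int[P]_w g (A l w, (S l w, (s w, v w))))%E.
  apply: (ae_integral_eq _ _ _ _ (S_ge0 l)) => //.
  - exact: measurable_completes.
  - by apply: measurableT_comp => //; exact: measurable_fun_pair.
  - by move=> w; rewrite lee_fin.
  - by move=> w Sw; rewrite completesE.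
rewrite independent_integral//; last by move=> z; rewrite lee_fin.
pose h (z : R * (R * R)) : \bar R :=
  ((z.1 <= z.2.2)%R%:R * erlang_cdf lam (l.+1 - n) (z.2.1 + z.2.2 - z.1))%:E.
have h0 z : (0 <= h z)%E by rewrite lee_fin mulr_ge0// erlang_cdf_ge0.
have mh : measurable_fun setT h.
  have n1 : measurable_fun setT (fun z : R * (R * R) => z.2.1).
    exact: measurableT_comp.
  have n2 : measurable_fun setT (fun z : R * (R * R) => z.2.2).
    exact: measurableT_comp.
  apply/measurable_EFinP; apply: measurable_funM.
    by apply: measurable_bool_natr; exact: measurable_fun_ler.
  apply: measurableT_comp; first exact: measurable_erlang_cdf.
  by apply: measurable_funB => //; exact: measurable_funD.
transitivity (\int[P]_w h (S l w, (s w, v w)))%E.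
  apply: eq_integral => w _; rewrite /g /h/=.
  case: (S l w <= v w); first by rewrite mul1r -A_law.
  by rewrite mul0r integral0.
exact: (same_law_pair_integral (mS l) mb msv).
Qed.

(** Positive parts keep the integrands nonnegative everywhere: [s0] is almost surely [s], and [r] is
    [v - b] on the event [b <= v] and 0 off it. *)
Let s0 w : R := Num.max 0 (s w).
Let r w : R := Num.max 0 (v w - b w).

(** Sum and integral are exchanged, and the Erlang series is evaluated at [s + v - b] on the event
    [b <= v]. The result is affine in [s], and independence of [s] from [(b, v)] factors the product
    term. *)
Lemma sum_completion_prob :
  (\sum_(0 <= l <oo) \int[P]_w
     ((completes (A l w) (s w) (v w) (S l w))%:R : R)%:E =
   n%:R%:E * P [set w | (b w <= v w)%R] +
   lam%:E * (P [set w | (b w <= v w)%R] * \int[P]_w (s0 w)%:E +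
             \int[P]_w (r w)%:E))%E.
Proof.
under eq_eseriesr do rewrite completion_prob.
have mbv : measurable_fun setT (fun w => b w <= v w) by exact: measurable_fun_ler.
have ms0 : measurable_fun setT s0 by exact: measurable_maxr.
have mr : measurable_fun setT r.
  by apply: measurable_maxr => //; exact: measurable_funB.
have s00 w : 0 <= s0 w by rewrite le_max lexx.
have r0 w : 0 <= r w by rewrite le_max lexx.
have mt l : measurable_fun setT (fun w =>
    ((b w <= v w)%R%:R * erlang_cdf lam (l.+1 - n) (s w + v w - b w))%:E).
  apply/measurable_EFinP; apply: measurable_funM.
    exact: measurable_bool_natr.
  apply: measurableT_comp; first exact: measurable_erlang_cdf.
  by apply: measurable_funB => //; exact: measurable_funD.
have t0 l w : (0 <= ((b w <= v w)%R%:R *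
    erlang_cdf lam (l.+1 - n) (s w + v w - b w))%:E)%E.
  by rewrite lee_fin mulr_ge0// erlang_cdf_ge0.
rewrite -integral_nneseries//.
have mbv' := measurable_bool_EFin mbv.
have ms0' : measurable_fun setT (EFin \o s0) by exact/measurable_EFinP.
have mr' : measurable_fun setT (EFin \o r) by exact/measurable_EFinP.
pose f1 w : \bar R := ((b w <= v w)%R%:R)%:E.
pose f2 w : \bar R := (f1 w * (s0 w)%:E)%E.
have mf2 : measurable_fun setT f2 by exact: emeasurable_funM.
have f10 w : (0 <= f1 w)%E by rewrite lee_fin.
have f20 w : (0 <= f2 w)%E by rewrite /f2 mule_ge0// lee_fin.
have r0' w : (0 <= (r w)%:E)%E by rewrite lee_fin.
have mfr : measurable_fun setT (fun w => f2 w + (r w)%:E)%E.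
  exact: emeasurable_funD.
have fr0 w : (0 <= f2 w + (r w)%:E)%E by exact: adde_ge0.
transitivity (\int[P]_w (n%:R%:E * f1 w + lam%:E * (f2 w + (r w)%:E)))%E.
  apply: (ae_integral_eq _ _ _ _ s_ge0) => [|||w|w sw].
  - by apply: ge0_emeasurable_sum.
  - apply: emeasurable_funD; exact: emeasurable_funM.
  - by move=> w; apply: nneseries_ge0.
  - by rewrite adde_ge0// mule_ge0// lee_fin ltW.
  rewrite /f2 /f1 /r /s0 (max_idPr sw); case: leP => bv; last first.
    rewrite eseries0; last by move=> i _ _; rewrite mul0r.
    have -> : Num.max 0 (v w - b w) = 0 by apply/max_idPl; rewrite subr_le0 ltW.
    by rewrite !mule0 mul0e adde0 mule0 adde0.
  under eq_eseriesr do rewrite mul1r.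
  rewrite sum_shifted_erlang_cdf//; last by lra.
  have -> : Num.max 0 (v w - b w) = v w - b w.
    by apply/max_idPr; rewrite subr_ge0.
  transitivity (n%:R * 1 + lam * (1 * s w + (v w - b w)))%:E => //.
  by congr (_%:E); ring.
rewrite ge0_integralD//; last 4 first.
- by move=> w _; apply: (mule_ge0 _ (f10 w)); rewrite lee_fin.
- exact: emeasurable_funM.
- by move=> w _; apply: (mule_ge0 _ (fr0 w)); rewrite lee_fin ltW.
- exact: emeasurable_funM.
rewrite ge0_integralZl//.
rewrite ge0_integralZl//; last by rewrite lee_fin ltW.
rewrite ge0_integralD// -integral_bool//; congr (_ + _ * (_ + _))%E.
pose k (z : R * R) : \bar R := ((z.1 <= z.2)%R%:R)%:E.
have mk : measurable_fun setT k.
  by apply: measurable_bool_EFin; exact: measurable_fun_ler.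
rewrite muleC; under eq_integral do rewrite /f2 muleC.
apply: (independent_integralM (f := fun x : R => (Num.max 0 x)%:E)
  (Y := fun w => (b w, v w)) (g := k)) => //.
- exact: measurable_fun_pair.
- by apply/measurable_EFinP; exact: measurable_maxr.
- by move=> x; rewrite lee_fin le_max lexx.
- by move=> x; rewrite lee_fin.
Qed.

End completions.

End queue.

(** * The cycle *)

Section expectations.
Context (d : measure_display) (T : measurableType d) (R : realType)
  (P : probability T R).

Lemma integral_positive_part (X : {RV P >-> R}) :
  {ae P, forall w, 0 <= X w} -> P.-integrable [set: T] (EFin \o X) ->
  (\int[P]_w (Num.max 0 (X w))%:E = (fine 'E_P[X])%:E)%E.
Proof.
move=> X0 iX; rewrite unlock fineK; last exact: integrable_fin_num.
apply: ae_eq_integral => //.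
- by apply/measurable_EFinP; exact: measurable_maxr.
- exact/measurable_EFinP.
- case: X0 => N [mN N0 XN]; exists N; split=> // w /= nX.
  by apply: XN => /= Xw; apply: nX => _; rewrite (max_idPr Xw).
Qed.

(** If the mean were 0, the positive part of [X] would vanish almost surely, and two null sets would
    cover the whole space. *)
Lemma expectation_gt0 (X : {RV P >-> R}) :
  {ae P, forall w, 0 < X w} -> P.-integrable [set: T] (EFin \o X) ->
  0 < fine 'E_P[X].
Proof.
move=> X0 iX.
have X0' : {ae P, forall w, 0 <= X w}.
  case: X0 => N [mN N0 XN]; exists N; split=> // w /= nX.
  by apply: XN => /= /ltW.
have EX := integral_positive_part X0' iX.
rewrite lt_neqAle -lee_fin -EX integral_ge0 ?andbT//; last first.
  by move=> w _; rewrite lee_fin le_max lexx.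
apply/negP => /eqP E0; move: EX; rewrite -E0.
have mX : measurable_fun [set: T] (fun w => (Num.max 0 (X w))%:E).
  by apply/measurable_EFinP; exact: measurable_maxr.
under eq_integral do rewrite -[(Num.max _ _)%:E]gee0_abs ?lee_fin ?le_max ?lexx//.
move/(ae_eq_integral_abs P measurableT mX) => [N [mN N0 XN]].
case: X0 => M [mM M0 XM].
have : P (N `|` M) = 1%E.
  rewrite -(probability_setT P); congr (P _); apply/seteqP; split=> // w _.
  have [Xw|Xw] := ltP 0 (X w).
    left; apply: XN => /= /(_ I)/= [] /max_idPl.
    by rewrite leNgt Xw.
  by right; apply: XM => /=; rewrite ltNge Xw.
by rewrite measureU0//= N0 => /eqP; rewrite eq_sym onee_eq0.
Qed.

End expectations.

(** * Expected throughput of a tour *)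

Section cycle.
Context (d : measure_display) (T : measurableType d) (R : realType)
  (P : probability T R) (N : nat) (lam : 'I_N -> R).
Variables (V D B : 'I_N -> {RV P >-> R}) (S U : 'I_N -> nat -> {RV P >-> R}).
Hypotheses (lam_gt0 : forall i, 0 < lam i)
    (V_gt0 : forall i, {ae P, forall w, 0 < V i w})
    (D_ge0 : forall i, {ae P, forall w, 0 <= D i w})
    (B_ge0 : forall i, {ae P, forall w, 0 <= B i w})
    (V_int : forall i, P.-integrable [set: T] (EFin \o V i))
    (D_int : forall i, P.-integrable [set: T] (EFin \o D i))
    (S_law : forall i l (A : set R), measurable A ->
       distribution P (S i l) A = distribution P (B i) A)
    (U_law : forall i k (A : set R), measurable A ->
       distribution P (U i k) A = exponential_prob (lam i) A)
    (indep : mutually_independent (inputs V D B S U)).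

Let gen := generated_measurable (inputs V D B S U).

Let gen_coord J x : J x -> gen J (inputs V D B S U x).
Proof. exact: generated_measurable_coord. Qed.

(** Every independence claim about the cycle reduces to a set of labels that contains those used by
    [f] and none used by [g]. *)
Let gen_indep J d1 (T1 : measurableType d1) d2 (T2 : measurableType d2)
    (f : T -> T1) (g : T -> T2) :
  gen J f -> gen (~` J) g -> independent_functions P f g.
Proof. by move=> gf gg; apply: generated_independent gf gg => //; exact: setICr. Qed.

Let gen_pair J d1 (T1 : measurableType d1) d2 (T2 : measurableType d2)
    (f : T -> T1) (g : T -> T2) :
  gen J f -> gen J g -> gen J (fun w => (f w, g w)).
Proof. by move=> gf gg; exact: measurable_fun_pair. Qed.

Let arrival_sum i k w : R := \sum_(j < k) U i j w.

Let gen_arrival_sum J i k : (forall j, (j < k)%N -> J (Interarrival i j)) ->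
  gen J (arrival_sum i k).
Proof.
move=> Jj; apply: measurable_sum => j.
exact: (gen_coord (Jj j (ltn_ord j))).
Qed.

Let gen_entry J (pi : 'S_N) (m : 'I_N) :
  (forall k : 'I_N, (k < m)%N -> J (Visit (pi k)) /\ J (Switch (pi k))) ->
  gen J (entry_time V D pi m).
Proof.
move=> Jk; rewrite /entry_time.
rewrite (_ : (fun w => _) = fun w =>
  \sum_(k < N) (if (k < m)%N then V (pi k) w + D (pi k) w else 0)); last first.
  by apply/funext => w; rewrite big_mkcond.
apply: measurable_sum => k; case: (boolP (k < m)%N) => km;
  last exact: measurable_cst.
have [JV JD] := Jk k km.
exact: (measurable_funD (gen_coord JV) (gen_coord JD)).
Qed.

Let V_ge0 i : {ae P, forall w, 0 <= V i w}.
Proof.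
case: (V_gt0 i) => M [mM M0 VM]; exists M; split=> // w /= nV.
by apply: VM => /= /ltW.
Qed.

(** Nonnegativity passes from [B i] to the individual service times through the law of the negative
    half-line. *)
Let S_ge0 i l : {ae P, forall w, 0 <= S i l w}.
Proof.
have mneg : measurable (`]-oo, 0[%classic : set R) by [].
exists (S i l @^-1` `]-oo, 0[); split.
- by rewrite -[_ @^-1` _]setTI; exact: measurable_funP.
- have -> : P (S i l @^-1` `]-oo, 0[) = P (B i @^-1` `]-oo, 0[) by exact: S_law.
  case: (B_ge0 i) => M [mM M0 BM]; apply: (subset_measure0 (B := M)) => //.
    by rewrite -[_ @^-1` _]setTI; exact: measurable_funP.
  by move=> w /=; rewrite in_itv/= => Bw; apply: BM => /=; rewrite leNgt Bw.
- by move=> w /= /negP; rewrite in_itv/= ltNge.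
Qed.

Let VD_ge0 : {ae P, forall w, forall i, 0 <= V i w /\ 0 <= D i w}.
Proof.
apply: (@filter_forall _ _ _ _ (ae_filter_ringOfSetsType P)) => i.
exact: (@filterI _ _ (ae_filter_ringOfSetsType P) _ _ (V_ge0 i) (D_ge0 i)).
Qed.

Let c i := fine 'E_P[V i] + fine 'E_P[D i].
Let p i := fine (P [set w | B i w <= V i w]).
Let excess i w : R := Num.max 0 (V i w - B i w).

Let c_gt0 i : 0 < c i.
Proof.
rewrite /c ltr_pwDl ?expectation_gt0// -lee_fin -integral_positive_part//.
by apply: integral_ge0 => w _; rewrite lee_fin le_max lexx.
Qed.

Let entry_ge0 (pi : 'S_N) (m : 'I_N) :
  {ae P, forall w, 0 <= entry_time V D pi m w}.
Proof.
apply: (@filterS _ _ (ae_filter_ringOfSetsType P) _ _ _ VD_ge0) => w VDw.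
by apply: sumr_ge0 => k _; have [? ?] := VDw (pi k); exact: addr_ge0.
Qed.

Let measurable_entry (pi : 'S_N) (m : 'I_N) :
  measurable_fun [set: T] (entry_time V D pi m).
Proof.
apply: (@generated_measurableW _ _ _ _ _ (inputs V D B S U) setT).
exact: gen_entry.
Qed.

(** Almost surely all visit and switch-over times are nonnegative, so the positive part of the sum
    is the sum of positive parts. *)
Let integral_entry (pi : 'S_N) (m : 'I_N) :
  (\int[P]_w (Num.max 0 (entry_time V D pi m w))%:E =
   (\sum_(k < N | (k < m)%N) c (pi k))%:E)%E.
Proof.
have mpos (X : {RV P >-> R}) :
    measurable_fun [set: T] (fun w => (Num.max 0 (X w))%:E).
  by apply/measurable_EFinP; exact: measurable_maxr.
have pos0 (X : {RV P >-> R}) w : (0 <= (Num.max 0 (X w))%:E)%E.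
  by rewrite lee_fin le_max lexx.
transitivity (\int[P]_w \sum_(k < N | (k < m)%N)
    ((Num.max 0 (V (pi k) w))%:E + (Num.max 0 (D (pi k) w))%:E))%E.
  apply: (ae_integral_eq _ _ _ _ VD_ge0) => [||w|w|w VDw].
  - by apply/measurable_EFinP; exact: measurable_maxr.
  - under eq_fun do rewrite -big_filter.
    by apply: emeasurable_sum => k; exact: emeasurable_funD.
  - by rewrite lee_fin le_max lexx.
  - by apply: sume_ge0 => k _; exact: adde_ge0.
  - have VD0 k : 0 <= V (pi k) w /\ 0 <= D (pi k) w by exact: VDw.
    rewrite (max_idPr _); last first.
      by apply: sumr_ge0 => k _; have [? ?] := VD0 k; exact: addr_ge0.
    rewrite -sumEFin; apply: eq_bigr => k _; have [V0 D0] := VD0 k.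
    by rewrite !(max_idPr _)// EFinD.
rewrite -sumEFin -big_filter; under eq_integral do rewrite -big_filter.
rewrite ge0_integral_sum//; last first.
- by move=> k w _; exact: adde_ge0.
- by move=> k; exact: emeasurable_funD.
by apply: eq_bigr => k _; rewrite ge0_integralD// !integral_positive_part// -EFinD.
Qed.

Let excess_fin i : (\int[P]_w (excess i w)%:E \is a fin_num)%E.
Proof.
have e0 w : (0 <= (excess i w)%:E)%E by rewrite lee_fin le_max lexx.
rewrite ge0_fin_numE; last exact: integral_ge0.
have me : measurable_fun [set: T] (fun w => (excess i w)%:E).
  by apply/measurable_EFinP; apply: measurable_maxr => //; exact: measurable_funB.
apply: (@le_lt_trans _ _ (\int[P]_w (Num.max 0 (V i w))%:E)%E); last first.
  by rewrite integral_positive_part// ltry.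
(* Replacing [B i] by its positive part changes the excess only on a null set and makes the bound by
   the positive part of [V i] hold everywhere. *)
pose g w : R := Num.max 0 (V i w - Num.max 0 (B i w)).
have mg : measurable_fun [set: T] (fun w => (g w)%:E).
  apply/measurable_EFinP; apply: measurable_maxr => //.
  by apply: measurable_funB => //; exact: measurable_maxr.
rewrite (ae_integral_eq me mg e0 _ (B_ge0 i)); last 2 first.
- by move=> w; rewrite lee_fin le_max lexx.
- by move=> w Bw; rewrite /excess /g (max_idPr Bw).
apply: ge0_le_integral => //.
- by move=> w _; rewrite lee_fin le_max lexx.
- by apply/measurable_EFinP; exact: measurable_maxr.
- move=> w _; rewrite lee_fin ge_max !le_max lexx/=.
  by apply/orP; right; rewrite lerBlDr lerDl le_max lexx.
Qed.

(** Of the three terms, only the last involves the position of the queue: it carries the mean entry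
    time. *)
Lemma queue_throughput (n : 'I_N -> nat) (pi : 'S_N) (m : 'I_N) :
  (\sum_(0 <= l <oo) \int[P]_w
    ((completes (arrival_time U n (pi m) l w) (entry_time V D pi m w)
                (V (pi m) w) (S (pi m) l w))%:R : R)%:E =
   ((n (pi m))%:R * p (pi m) +
    lam (pi m) * fine (\int[P]_w (excess (pi m) w)%:E) +
    lam (pi m) * p (pi m) * \sum_(k < N | (k < m)%N) c (pi k))%:E)%E.
Proof.
set i := pi m; set s := entry_time V D pi m.
pose A l w := arrival_time U n i l w.
have AE l : A l = arrival_sum i (l.+1 - n i).
  by apply/funext => w; rewrite /A arrival_timeE.
pose arrivals : set (input N) :=
  [set x | if x is Interarrival _ _ then True else False].
have gs J : (forall k, J (Visit k) /\ J (Switch k)) -> gen J s.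
  by move=> Jk; apply: gen_entry => k _; exact: Jk.
have mA l : measurable_fun [set: T] (A l).
  by rewrite AE; apply: (generated_measurableW (J := setT) (gen_arrival_sum _)).
have A_law l y : (\int[P]_w ((A l w <= y)%R%:R : R)%:E =
    (erlang_cdf (lam i) (l.+1 - n i) y)%:E)%E.
  rewrite AE.
  apply: (@erlang_sum _ _ _ P (fun k => U i k : T -> R)) => // k; last first.
    by move=> C mC; exact: U_law.
  apply: (@gen_indep [set Interarrival i k]).
    exact: (gen_coord (x := Interarrival i k)).
  apply: gen_arrival_sum => j jk /= [jE].
  by rewrite jE ltnn in jk.
have A_indep l :
    independent_functions P (A l) (fun w => (S i l w, (s w, V i w))).
  rewrite AE; apply: (@gen_indep arrivals); first exact: gen_arrival_sum.
  apply: gen_pair; first by apply: (@gen_coord _ (CustomerService i l)).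
  apply: gen_pair; last by apply: (@gen_coord _ (Visit i)).
  by apply: gs => k; split=> -[].
have S_indep l : independent_functions P (S i l) (fun w => (s w, V i w)).
  apply: (@gen_indep [set CustomerService i l]).
    by apply: (@gen_coord _ (CustomerService i l)).
  apply: gen_pair; last by apply: (@gen_coord _ (Visit i)).
  by apply: gs => k; split=> -[].
have B_indep : independent_functions P (B i) (fun w => (s w, V i w)).
  apply: (@gen_indep [set Service i]).
    by apply: (@gen_coord _ (Service i)).
  apply: gen_pair; last by apply: (@gen_coord _ (Visit i)).
  by apply: gs => k; split=> -[].
have s_indep : independent_functions P s (fun w => (B i w, V i w)).
  (* The entry time uses only queues at positions before [m]; injectivity of [pi] keeps [Visit i]
     out of this set. *)
  apply: (@gen_indep [set x | exists2 k : 'I_N, (k < m)%N &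
      x = Visit (pi k) \/ x = Switch (pi k)]).
    by apply: gen_entry => k km; split; exists k => //; [left|right].
  apply: gen_pair.
    by apply: (@gen_coord _ (Service i)) => -[k _ []].
  apply: (@gen_coord _ (Visit i)) => -[k km []// [/perm_inj ik]].
  by rewrite ik ltnn in km.
rewrite (@sum_completion_prob _ _ _ P A (S i) s (V i) (B i) (lam i) (n i)) //.
- have -> : P [set w | (B i w <= V i w)%R] = (p i)%:E.
    rewrite /p fineK// fin_num_measure//.
    rewrite -[X in measurable X]setTI.
    exact: (measurable_fun_ler (f := B i) (g := V i)).
  rewrite integral_entry -(fineK (excess_fin i)).
  transitivity ((n i)%:R * p i + lam i * (p i * (\sum_(k < N | (k < m)%N) c (pi k)) +
    fine (\int[P]_w (excess i w)%:E)))%:E => //.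
  by congr (_%:E); ring.
- exact: measurable_entry.
- exact: entry_ge0.
- by move=> l C mC; exact: S_law.
Qed.

(** The part of the throughput that does not depend on the order; it is finite, so it cancels in
    comparisons. *)
Let offset (n : 'I_N -> nat) : R :=
  \sum_i ((n i)%:R * p i + lam i * fine (\int[P]_w (excess i w)%:E)).

Lemma expected_throughputE (n : 'I_N -> nat) (pi : 'S_N) :
  expected_throughput V D S U n pi = (offset n + ordering_value lam p c pi)%:E.
Proof.
rewrite /expected_throughput /throughput.
have mA i l : measurable_fun [set: T] (arrival_time U n i l).
  rewrite (_ : arrival_time U n i l = arrival_sum i (l.+1 - n i)).
    exact: (generated_measurableW (J := setT) (gen_arrival_sum _)).
  by apply/funext => w; rewrite arrival_timeE.
have mt (m : 'I_N) l : measurable_fun [set: T] (fun w =>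
    ((completes (arrival_time U n (pi m) l w) (entry_time V D pi m w)
                (V (pi m) w) (S (pi m) l w))%:R : R)%:E).
  have mS l' : measurable_fun [set: T] (S (pi m) l') by exact: measurable_funP.
  exact: (measurable_completes (mA (pi m)) mS (measurable_entry pi m)).
have t0 (m : 'I_N) l w : (0 <= ((completes (arrival_time U n (pi m) l w)
    (entry_time V D pi m w) (V (pi m) w) (S (pi m) l w))%:R : R)%:E)%E.
  by rewrite lee_fin.
rewrite ge0_integral_sum//; last 2 first.
- by move=> m; exact: ge0_emeasurable_sum.
- by move=> m w _; exact: nneseries_ge0.
under eq_bigr => m _ do rewrite integral_nneseries// queue_throughput.
rewrite sumEFin big_split/= /offset /ordering_value.
(* Summing over positions or over queues gives the same offset, since [pi] is a bijection. *)
by congr (_ + _)%:E; rewrite [RHS](reindex_inj (@perm_inj _ pi)).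
Qed.

Lemma optimal_orderP (n : 'I_N -> nat) (pi : 'S_N) :
  optimal_order V D S U n pi <->
  (forall k m : 'I_N, (k <= m)%N ->
     order_index lam V D B (pi k) <= order_index lam V D B (pi m)).
Proof.
(* Unfolding [order_index] makes the index condition convertible to [sorted_order]. *)
rewrite -[X in _ <-> X]/(sorted_order lam p c pi) -(optimal_ordering _ _ c_gt0).
split=> opt pi'.
  by have := opt pi'; rewrite !expected_throughputE lee_fin lerD2l.
by rewrite !expected_throughputE lee_fin lerD2l; exact: opt.
Qed.

End cycle.

Theorem theorem1 (d : measure_display) (T : measurableType d) (R : realType)
    (P : probability T R) (N : nat) (hN : (2 <= N)%N) (lam : 'I_N -> R)
    (V D B : 'I_N -> {RV P >-> R}) (S U : 'I_N -> nat -> {RV P >-> R})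
    (lam_gt0 : forall i, 0 < lam i)
    (V_gt0 : forall i, {ae P, forall w, 0 < V i w})
    (D_ge0 : forall i, {ae P, forall w, 0 <= D i w})
    (B_ge0 : forall i, {ae P, forall w, 0 <= B i w})
    (V_int : forall i, P.-integrable [set: T] (EFin \o V i))
    (D_int : forall i, P.-integrable [set: T] (EFin \o D i))
    (S_law : forall i l (A : set R), measurable A ->
       distribution P (S i l) A = distribution P (B i) A)
    (U_law : forall i k (A : set R), measurable A ->
       distribution P (U i k) A = exponential_prob (lam i) A)
    (indep : mutually_independent (inputs V D B S U)) :
  (forall (n : 'I_N -> nat) (pi : 'S_N),
     optimal_order V D S U n pi <->
     (forall k m : 'I_N, (k <= m)%N ->
        order_index lam V D B (pi k) <= order_index lam V D B (pi m))) /\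
  (forall (n n' : 'I_N -> nat) (pi : 'S_N),
     optimal_order V D S U n pi <-> optimal_order V D S U n' pi).
Proof.
split=> [n pi|n n' pi].
  exact: optimal_orderP lam_gt0 V_gt0 D_ge0 B_ge0 V_int D_int S_law U_law indep n pi.
(* Optimality for [n] and for [n'] are both equivalent to the same condition, which mentions neither
   state. *)
rewrite (optimal_orderP lam_gt0 V_gt0 D_ge0 B_ge0 V_int D_int S_law U_law indep n).
by rewrite (optimal_orderP lam_gt0 V_gt0 D_ge0 B_ge0 V_int D_int S_law U_law indep n').
Qed.
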